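(* For every $\varepsilon>0$, every $M>0$ and every $N\in\mathbb{N}$, there exists a dictionary $D=D(\varepsilon,M,N)\subset\mathbb{R}^{N+1}$ with the following property: for every sequence $M>d_0>d_1>\dots>d_N>0$ with $\min\{d_{n-1}-d_n:\ n=1,\dots,N\}>\varepsilon$ there exists an element $x\in\mathbb{R}^{N+1}$ with $\sigma_n(x)=d_n$ for $n=0,\dots,N$.
   Context: $\mathbb{N}=\{1,2,\dots\}$, and $\mathbb{R}^{N+1}$ carries the Euclidean norm $|\cdot|$. A dictionary in $\mathbb{R}^{N+1}$ is a subset $D$ of the unit sphere whose linear span is $\mathbb{R}^{N+1}$. For $m\in\mathbb{N}$, $\Sigma_m(D)=\{\sum_{k=1}^m\lambda_kg_k:\ \lambda_k\in\mathbb{R},\ g_k\in D\}$, $\sigma_m(x)=\mathrm{dist}(x,\Sigma_m(D))$, and $\sigma_0(x)=|x|$. *)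

(* Defs.v *)
From HB Require Import structures.
From mathcomp Require Import all_boot all_order all_algebra.
From mathcomp Require Import boolp classical_sets reals.
Set Implicit Arguments.
Unset Strict Implicit.
Unset Printing Implicit Defensive.
Import Order.TTheory GRing.Theory Num.Theory.
Local Open Scope classical_set_scope.
Local Open Scope ring_scope.

(* Row vectors carry the sup norm in MathComp-Analysis, hence a separate
   Euclidean norm. *)
Definition enorm {R : realType} {n : nat} (x : 'rV[R]_n) : R :=
  Num.sqrt (\sum_(i < n) x 0 i ^+ 2).

Definition edist_set {R : realType} {n : nat} (x : 'rV[R]_n)
    (A : set 'rV[R]_n) : R :=
  inf [set enorm (x - y) | y in A].

(* [D] may be infinite, whereas [<<s>>%VS] is the span of a finite sequence. *)
Definition linear_span {R : realType} {n : nat} (D : set 'rV[R]_n) :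
    set 'rV[R]_n :=
  [set x | exists2 s : seq 'rV[R]_n,
             (forall g, g \in s -> D g) & x \in <<s>>%VS].

Definition dictionary {R : realType} {n : nat} (D : set 'rV[R]_n) : Prop :=
  D `<=` [set g | enorm g = 1] /\ linear_span D = setT.

(* The [g k] need not be distinct. *)
Definition Sigma {R : realType} {n : nat} (m : nat) (D : set 'rV[R]_n) :
    set 'rV[R]_n :=
  [set x | exists (lambda : 'I_m -> R) (g : 'I_m -> 'rV[R]_n),
             (forall k, D (g k)) /\ x = \sum_(k < m) lambda k *: g k].

Definition sigma {R : realType} {n : nat} (D : set 'rV[R]_n) (m : nat)
    (x : 'rV[R]_n) : R :=
  if m is 0 then enorm x else edist_set x (Sigma m D).

(* Main.v *)
Require Import Defs.
From mathcomp Require Import all_boot all_order all_algebra.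
From mathcomp Require Import boolp classical_sets reals.
From mathcomp Require Import ring lra zify.
Set Implicit Arguments.
Unset Strict Implicit.
Unset Printing Implicit Defensive.
Import Order.TTheory GRing.Theory Num.Theory.
Local Open Scope ring_scope.

(** The dictionary consists of [N.+1] vectors [g_0, ..., g_N] on a moment
    curve that is squeezed towards the first coordinates: before
    normalization, [g_k] has coordinates [(- delta)^i N_i(k)], where [N_i(t)
    = t (t - 1) ... (t - i + 1)] is the Newton polynomial. As [delta] tends
    to 0, the span of any [n] of these vectors tends to the coordinate
    subspace [L_n] of the first [n] coordinates, and since [N_i(k) = 0] for
    [k < i], the span of [g_0, ..., g_(n-1)] equals [L_n] exactly
    ([triangular_span]).

    Given the distances, take [x] with coordinates [a_i = sqrt (d_i^2 -
    d_(i+1)^2)] and [a_N = d_N]. Its distance to [L_n] is [d_n], so it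
    remains to see that [L_n] is not merely an approximately but an exactly
    optimal choice: any other [n] vectors of the dictionary do at least as
    badly ([tail_le_dist]). Hence the prescribed values are attained exactly,
    not only up to a small error.

    Let [S] be a set of [n] indices. If [w] is orthogonal to all [g_k] with
    [k] in [S], then every [y] in their span satisfies [|x - y|^2 >= 2 <w,
    x> - |w|^2] ([dual_bound]). Take [w] equal to [x] in the coordinates
    from [n] on, and equal in the first [n] coordinates to the unique [u]
    that makes [w] orthogonal to the [g_k] ([correction],
    [correction_orth]). The bound becomes [d_n^2 + 2 <x, u> - |u|^2], so one
    wants [2 <x, u> >= |u|^2]. Now [u] comes from reducing [N_n, ..., N_N]
    modulo the polynomial with roots [S], and up to second order in [delta]
    it is [delta a_n kappa] in the coordinate [n - 1] and zero elsewhere,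
    where [kappa] is the sum of [S] minus the sum of [0, ..., n - 1]
    ([newton_reduce]). Unless [S] is initial, [kappa >= 1]
    ([initial_or_sum_gt]). The gap condition gives [a_(n-1) >= eps], and so
    the first-order term [2 delta a_n kappa a_(n-1)] wins for small [delta]
    ([correction_gain]). The tail of [x] from [n] on, and with it [u], is
    bounded by a fixed multiple of [a_n], so the threshold for [delta]
    depends only on [eps], [M] and [N], even though [a_N = d_N] has no
    positive lower bound. *)

(** * Newton polynomials on subsets of the nodes *)

Definition newton {R : nzRingType} (i : nat) : {poly R} :=
  \prod_(j < i) ('X - (j%:R)%:P).

Lemma size_newton (R : nzRingType) i : size (newton i : {poly R}) = i.+1.
Proof. by rewrite size_prod_XsubC /index_enum -enumT size_enum_ord. Qed.

Lemma monic_newton (R : nzRingType) i : (newton i : {poly R}) \is monic.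
Proof. exact: monic_prod_XsubC. Qed.

Lemma coefPn_newton (R : comNzRingType) n : (0 < n)%N ->
  (newton n)`_n.-1 = - \sum_(i < n) (i : nat)%:R :> R.
Proof.
case: n => // n _; have := @coefPn_prod_XsubC R [seq i%:R | i : 'I_n.+1].
by rewrite size_map size_enum_ord !big_image => /(_ isT).
Qed.

Lemma newton_horner_eq0 (R : comNzRingType) i k :
  (k < i)%N -> (newton i).[k%:R] = 0 :> R.
Proof.
move=> ki; rewrite horner_prod (bigD1 (Ordinal ki)) //= hornerXsubC subrr.
by rewrite mul0r.
Qed.

Lemma newton_horner_gt0 (R : realType) i : 0 < (newton i).[i%:R] :> R.
Proof.
rewrite horner_prod prodr_gt0 // => j _.
by rewrite hornerXsubC subr_gt0 ltr_nat.
Qed.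

(** The coefficient on the top Newton polynomial is recorded, because all
    the [newton i] are monic and it is the only one whose sign will matter. *)
Lemma newton_expansion (R : nzRingType) n (p : {poly R}) :
  (size p <= n)%N ->
  exists c : nat -> R, p = \sum_(i < n) c i *: newton i /\
    forall j, n = j.+1 -> c j = p`_j.
Proof.
elim: n p => [|n IHn] p sz_p.
  exists (fun=> 0); split=> //.
  by rewrite big_ord0; apply/eqP; rewrite -size_poly_leq0.
have coef_n : (newton n : {poly R})`_n = 1.
  by have /monicP := monic_newton R n; rewrite lead_coefE size_newton.
have [|c [p_def _]] := IHn (p - p`_n *: newton n).
  apply/leq_sizeP => j nj; rewrite coefB coefZ.
  have [->|ne_jn] := eqVneq j n; first by rewrite coef_n mulr1 subrr.
  have {ne_jn}nj : (n < j)%N by rewrite ltn_neqAle eq_sym ne_jn nj.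
  have /leq_sizeP -> // := sz_p.
  by have /leq_sizeP -> // : (size (newton n : {poly R}) <= n.+1)%N;
    rewrite ?size_newton // mulr0 subrr.
exists (fun i => if i == n then p`_n else c i); split; last first.
  by move=> j [->]; rewrite eqxx.
rewrite big_ord_recr /= eqxx.
under eq_bigr => i _ do rewrite (ltn_eqF (ltn_ord i)).
by rewrite -p_def subrK.
Qed.

(** Restricted to the nodes [S], every polynomial is a combination of the
    first [#|S|] Newton polynomials: the remainder modulo [\prod_(k in S)
    ('X - k)]. For [newton #|S|] the remainder is the difference of two
    monic polynomials of the same degree, so its top coefficient compares
    the sums of their roots. *)
Lemma newton_reduce (R : realType) (N : nat) (S : {set 'I_N.+1}) :
  exists r : nat -> nat -> R,
    (forall m (k : 'I_N.+1), k \in S ->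
       (newton m).[k%:R] = \sum_(i < #|S|) r m i * (newton i).[k%:R]) /\
    (forall j, #|S| = j.+1 ->
       r #|S| j = \sum_(k in S) (k : nat)%:R - \sum_(i < #|S|) (i : nat)%:R).
Proof.
pose s : seq R := [seq (k : nat)%:R | k : 'I_N.+1 in S].
have sz_s : size s = #|S| by rewrite size_image.
pose Q := \prod_(x <- s) ('X - x%:P).
have sz_Q : size Q = #|S|.+1 by rewrite size_prod_XsubC sz_s.
have Q_neq0 : Q != 0 by rewrite -size_poly_gt0 sz_Q.
have Q_root (k : 'I_N.+1) : k \in S -> Q.[k%:R] = 0.
  by move=> kS; apply/rootP; rewrite root_prod_XsubC fintype.image_f.
have/choice [r rP] m : exists c : nat -> R,
    newton m %% Q = \sum_(i < #|S|) c i *: newton i /\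
    forall j, #|S| = j.+1 -> c j = (newton m %% Q)`_j.
  by apply: newton_expansion; rewrite -ltnS -sz_Q ltn_modp.
exists r; split=> [m k kS|j cardS].
  rewrite {1}(divp_eq (newton m) Q) hornerD hornerM Q_root // mulr0 add0r.
  rewrite (rP m).1 horner_sum.
  by under eq_bigr => i _ do rewrite hornerZ.
rewrite (rP _).2 //.
have -> : newton #|S| %% Q = newton #|S| - Q.
  rewrite -{1}(subrK Q (newton #|S|)) modpD modpp addr0 modp_small //.
  rewrite sz_Q ltnS; apply/leq_sizeP => i; rewrite leq_eqVlt coefB.
  case/predU1P=> [<-|lt_i].
    have /monicP := monic_newton R #|S|; rewrite lead_coefE size_newton => ->.
    have /monicP : Q \is monic by apply: monic_prod_XsubC.
    by rewrite lead_coefE sz_Q => ->; rewrite subrr.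
  by rewrite !nth_default ?subrr ?sz_Q ?size_newton.
have coefQ : Q`_j = - \sum_(k in S) (k : nat)%:R.
  have := @coefPn_prod_XsubC _ s; rewrite sz_s cardS => /(_ isT) ->.
  by rewrite big_image.
have coefN : (newton #|S|)`_j = - \sum_(i < #|S|) (i : nat)%:R :> R.
  by rewrite -coefPn_newton ?cardS.
by rewrite coefB coefQ coefN opprK addrC.
Qed.

(** Exchange argument: the indices of [S] that are at least [#|S|] are
    exactly as many as the indices below [#|S|] that [S] misses, and each is
    larger. Together with [newton_reduce] this gives the sign of the leading
    correction. *)
Lemma initial_or_sum_gt (N : nat) (S : {set 'I_N.+1}) :
  {in S, forall k : 'I_N.+1, (k < #|S|)%N} \/
  (\sum_(i < #|S|) i < \sum_(k in S) k)%N.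
Proof.
pose T := [set k : 'I_N.+1 | (k < #|S|)%N].
have [/fintype.subsetP ST|nST] := boolP (S \subset T).
  by left=> k /ST; rewrite inE.
right.
have leS : (#|S| <= N.+1)%N by rewrite -[leqRHS]card_ord max_card.
have sumT : (\sum_(k in T) k = \sum_(i < #|S|) i)%N.
  rewrite (big_ord_widen _ (fun i : nat => i) leS).
  by apply: eq_bigl => k; rewrite inE.
have cardT : #|T| = #|S|.
  transitivity (\sum_(i < #|S|) 1)%N.
    2: by rewrite sum_nat_const card_ord muln1.
  rewrite (big_ord_widen _ (fun=> 1%N) leS) -sum1_card.
  by apply: eq_bigl => k; rewrite inE.
have cardD : #|S :\: T| = #|T :\: S|.
  have := cardsID T S; have := cardsID S T.
  by rewrite finset.setIC cardT => <- /addnI.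
have D_gt0 : (0 < #|S :\: T|)%N by rewrite card_gt0 finset.setD_eq0.
have geS : (#|S :\: T| * #|S| <= \sum_(k in S :\: T) k)%N.
  by rewrite -sum_nat_const leq_sum // => k; rewrite !inE -leqNgt; case/andP.
have leT : (\sum_(k in T :\: S) k + #|T :\: S| <= #|T :\: S| * #|S|)%N.
  rewrite -sum_nat_const -sum1_card -big_split leq_sum //= => k.
  by rewrite !inE addn1 => /andP[].
rewrite -sumT (big_setID S) [ltnRHS](big_setID T) /= finset.setIC.
rewrite ltn_add2l (leq_trans _ geS) // cardD (leq_trans _ leT) //.
by rewrite -[ltnLHS]addn0 ltn_add2l -cardD.
Qed.

(** * Lower bound for distances by duality *)

(** Duality: for [w] orthogonal to the subspace, [z] and [a] have the same
    inner product with [w], so [|z|^2 >= 2 <w, z> - |w|^2 = 2 <w, a> -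
    |w|^2] for every point [z] of the affine space through [a] directed by
    the [G k] with [k] in [S]. When [w] agrees with [a] from index [c] on, the right-hand side is the squared
    tail of [a] plus the sum that is assumed nonnegative. *)
Lemma dual_bound (R : realType) (n c : nat) (S : {set 'I_n})
    (G : 'I_n -> 'I_n -> R) (a w z lam : 'I_n -> R) :
  {in S, forall k, \sum_i w i * G k i = 0} ->
  (forall i : 'I_n, (c <= i)%N -> w i = a i) ->
  0 <= \sum_(i < n | (i < c)%N) (2 * a i * w i - w i ^+ 2) ->
  (forall i, z i = a i - \sum_(k in S) lam k * G k i) ->
  \sum_(i < n | (c <= i)%N) a i ^+ 2 <= \sum_i z i ^+ 2.
Proof.
move=> w_orth w_tail w_gain z_def.
have lower : \sum_i (2 * w i * z i - w i ^+ 2) <= \sum_i z i ^+ 2.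
  by apply: ler_sum => i _; have := sqr_ge0 (z i - w i); nra.
have wz : \sum_i w i * z i = \sum_i a i * w i.
  under eq_bigr => i _ do rewrite z_def mulrBr mulr_sumr mulrC.
  rewrite sumrB exchange_big /= [X in _ - X]big1 ?subr0 // => k kS.
  transitivity (lam k * \sum_i w i * G k i); last by rewrite w_orth // mulr0.
  by rewrite mulr_sumr; apply: eq_bigr => i _; rewrite mulrCA.
apply: le_trans lower.
have -> : \sum_i (2 * w i * z i - w i ^+ 2)
          = \sum_i (2 * a i * w i - w i ^+ 2).
  rewrite !sumrB; congr (_ - _).
  under eq_bigr => i _ do rewrite -mulrA.
  by under [RHS]eq_bigr => i _ do rewrite -mulrA; rewrite -!mulr_sumr wz.
rewrite [leRHS](bigID (fun i : 'I_n => (i < c)%N)) /=.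
rewrite -[leLHS]add0r lerD //; under [leRHS]eq_bigl => i do rewrite -leqNgt.
by apply: ler_sum => i ci; rewrite w_tail //; nra.
Qed.

(** The first [c] coordinates that make the tail of [a] orthogonal to the
    stretched vectors at [c] nodes, when [r m] expresses [newton m] on these
    nodes by the Newton polynomials of lower index; see [correction_orth]. *)
Definition correction {R : realType} (N c : nat) (r : nat -> nat -> R)
    (delta : R) (a : nat -> R) (i : nat) : R :=
  - \sum_(m < N.+1 | (c <= m)%N) a m * (- delta) ^+ (m - i) * r m i.

(** Only the pair [m = b.+1], [i = b] contributes at first order in [delta];
    all other terms carry a factor [delta ^+ 2]. *)
Lemma correction_split (R : realType) (N b : nat) (r : nat -> nat -> R)
    (delta : R) (a : nat -> R) (i : nat) : (b < N)%N -> (i <= b)%N ->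
  correction N b.+1 r delta a i =
  (if i == b then delta * a b.+1 * r b.+1 b else 0)
  - \sum_(m < N.+1 | (b < m)%N && (i.+1 < m)%N)
       a m * (- delta) ^+ (m - i) * r m i.
Proof.
move=> bN ib; rewrite /correction.
case: eqVneq => [->|ne_ib].
  rewrite (bigD1 (Ordinal (bN : b.+1 < N.+1)%N)) //= subSnn expr1 opprD.
  congr (_ - _); first by ring.
  by apply: eq_bigl => m; rewrite -val_eqE /=; lia.
by rewrite add0r; congr (- _); apply: eq_bigl => m; lia.
Qed.

(** One coordinate of the gain [2 <a, u> - |u|^2], with [u = s - e]: both
    the error [e] and the square cost only order [A * delta ^+ 2]. The
    factor [A] is kept in every bound, since it may be arbitrarily small. *)
Lemma perturbed_gain (R : realType) (delta kappa a A M B s e : R) :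
  0 < delta <= 1 -> 0 <= kappa -> 0 <= B -> 0 <= a <= M -> 0 <= A <= M ->
  0 <= s <= delta * A * kappa -> `|e| <= A * B * delta ^+ 2 ->
  2 * (a * s) - A * delta ^+ 2 * (2 * M * B + M * (kappa + B) ^+ 2)
  <= 2 * a * (s - e) - (s - e) ^+ 2.
Proof.
move=> /andP[delta_gt0 delta_le1] kappa_ge0 B_ge0.
move=> /andP[a_ge0 aM] /andP[A_ge0 AM].
move=> /andP[s_ge0 s_le] e_le.
have AB_ge0 : 0 <= A * B by rewrite mulr_ge0.
have lin : a * e <= M * (A * B * delta ^+ 2).
  apply: le_trans (ler_wpM2l a_ge0 (le_trans (ler_norm e) e_le)) _.
  by rewrite ler_wpM2r // mulr_ge0 // sqr_ge0.
have norm_le : `|s - e| <= A * delta * (kappa + B).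
  apply: le_trans (ler_normB _ _) _; rewrite (ger0_norm s_ge0).
  have -> : A * delta * (kappa + B) = delta * A * kappa + A * B * delta by ring.
  apply: lerD => //; apply: le_trans e_le _; rewrite ler_wpM2l //.
  by rewrite expr2 ler_piMl // ltW.
have quad : (s - e) ^+ 2 <= A * delta ^+ 2 * (M * (kappa + B) ^+ 2).
  rewrite -real_normK ?num_real //.
  apply: (@le_trans _ _ ((A * delta * (kappa + B)) ^+ 2)).
    by rewrite !expr2 ler_pM.
  have -> : (A * delta * (kappa + B)) ^+ 2
            = A * (A * (delta * (kappa + B)) ^+ 2) by ring.
  have -> : A * delta ^+ 2 * (M * (kappa + B) ^+ 2)
            = A * (M * (delta * (kappa + B)) ^+ 2) by ring.
  by rewrite ler_wpM2l // ler_wpM2r // sqr_ge0.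
have -> : A * delta ^+ 2 * (2 * M * B + M * (kappa + B) ^+ 2)
          = 2 * (M * (A * B * delta ^+ 2))
            + A * delta ^+ 2 * (M * (kappa + B) ^+ 2) by ring.
have -> : 2 * a * (s - e) = 2 * (a * s) - 2 * (a * e) by ring.
by rewrite opprD addrA lerB // lerB // ler_wpM2l.
Qed.

(** The first-order term of the correction is positive, as is [a b], so it
    increases the gain by at least [2 * eps * A * delta] with [A = a b.+1],
    whereas everything else is [O(A * delta ^+ 2)]. Bounding the tail of [a]
    by a multiple of [A], and not only by [M], is what makes the threshold
    on [delta] independent of [a]. *)
Lemma correction_gain (R : realType) (N b : nat) (r : nat -> nat -> R)
    (eps M K : R) :
  (b < N)%N -> 0 < eps -> 0 <= M -> 0 <= K -> 1 <= r b.+1 b ->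
  exists2 delta0, 0 < delta0 & forall delta, 0 < delta <= delta0 ->
    forall a : nat -> R,
      eps <= a b -> (forall i, (i <= N)%N -> 0 <= a i <= M) ->
      (forall m, (b < m <= N)%N -> a m <= K * a b.+1) ->
      0 <= \sum_(i < N.+1 | (i < b.+1)%N)
             (2 * a i * correction N b.+1 r delta a i
              - correction N b.+1 r delta a i ^+ 2).
Proof.
move=> bN eps_gt0 M_ge0 K_ge0 kappa_ge1.
pose C := \sum_(i < N.+1) \sum_(m < N.+1) `|r m i|.
have C_ge0 : 0 <= C by apply: sumr_ge0 => i _; apply: sumr_ge0.
set kappa := r b.+1 b in kappa_ge1.
have kappa_ge0 : 0 <= kappa by apply: le_trans kappa_ge1.
pose B := K * C; have B_ge0 : 0 <= B by exact: mulr_ge0.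
pose E := 2 * M * B + M * (kappa + B) ^+ 2.
have E_ge0 : 0 <= E.
  by rewrite addr_ge0 // mulr_ge0 ?sqr_ge0 // mulr_ge0.
have den_gt0 : 0 < N.+1%:R * E + 1 by rewrite ltr_pwDr // mulr_ge0.
exists (Num.min 1 (eps / (N.+1%:R * E + 1))).
  by rewrite lt_min ltr01 divr_gt0.
move=> delta /andP[delta_gt0]; rewrite le_min => /andP[delta_le1].
rewrite ler_pdivlMr // => delta_small a ab aM aK.
set A := a b.+1 in aK.
have /andP[A_ge0 A_leM] : 0 <= A <= M by apply: aM.
(* Second-order part of the correction, as in [correction_split]. *)
pose rest i := \sum_(m < N.+1 | (b < m)%N && (i.+1 < m)%N)
  a m * (- delta) ^+ (m - i) * r m i.
have rest_le i : (i <= b)%N -> `|rest i| <= A * B * delta ^+ 2.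
  move=> ib; apply: le_trans (ler_norm_sum _ _ _) _.
  apply: (@le_trans _ _ (\sum_(m < N.+1) K * A * delta ^+ 2 * `|r m i|)).
    rewrite [leRHS](bigID (fun m : 'I_N.+1 => (b < m)%N && (i.+1 < m)%N)) /=.
    rewrite -[leLHS]addr0 lerD //; last first.
      by apply: sumr_ge0 => m _; rewrite !mulr_ge0 ?exprn_ge0 // ltW.
    apply: ler_sum => m /andP[bm im].
    have mN : (m <= N)%N by rewrite -ltnS.
    have /andP[am_ge0 _] := aM m mN.
    rewrite !normrM normrX normrN (ger0_norm am_ge0) (gtr0_norm delta_gt0).
    rewrite ler_wpM2r // ler_pM ?exprn_ge0 ?(ltW delta_gt0) ?aK ?bm //.
    by rewrite ler_wiXn2l ?(ltW delta_gt0) // ltn_subRL addn1.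
  rewrite -mulr_sumr.
  have -> : A * B * delta ^+ 2 = K * A * delta ^+ 2 * C by rewrite /B; ring.
  rewrite ler_wpM2l ?mulr_ge0 ?exprn_ge0 ?(ltW delta_gt0) //.
  have iN : (i < N.+1)%N by rewrite (leq_ltn_trans ib) // ltnW.
  rewrite /C [leRHS](bigD1 (Ordinal iN)) //= lerDl.
  by apply: sumr_ge0 => j _; apply: sumr_ge0.
have term i : (i <= b)%N ->
    (if i == b then 2 * eps * A * delta else 0) - A * delta ^+ 2 * E <=
    2 * a i * correction N b.+1 r delta a i
    - correction N b.+1 r delta a i ^+ 2.
  move=> ib; rewrite correction_split // -/(rest i) -/A -/kappa.
  have /andP[ai_ge0 ai_le] : 0 <= a i <= M.
    by rewrite aM // (leq_trans ib) // ltnW.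
  set s := (if i == b then delta * A * kappa else 0).
  have dAk_ge0 : 0 <= delta * A * kappa by rewrite !mulr_ge0 // ltW.
  have s_bd : 0 <= s <= delta * A * kappa.
    by rewrite /s; case: ifP => _; rewrite ?lexx ?dAk_ge0.
  have main : (if i == b then 2 * eps * A * delta else 0) <= 2 * (a i * s).
    rewrite /s; case: eqP => [->|_]; last by rewrite !mulr0.
    have -> : 2 * eps * A * delta = 2 * (delta * A) * (eps * 1) by ring.
    have -> : 2 * (a b * (delta * A * kappa)) = 2 * (delta * A) * (a b * kappa).
      by ring.
    by rewrite ler_wpM2l ?ler_pM ?mulr_ge0 // ltW.
  apply: (le_trans (lerD main (lexx _))).
  by apply: perturbed_gain; rewrite ?delta_gt0 ?ai_ge0 ?A_ge0 ?rest_le.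
apply: (@le_trans _ _ (\sum_(i < N.+1 | (i < b.+1)%N)
  ((if (i : nat) == b then 2 * eps * A * delta else 0) - A * delta ^+ 2 * E))).
  2: by apply: ler_sum => i ib; apply: term.
rewrite sumrB (bigD1 (Ordinal (ltnW bN : b < N.+1)%N)) //= eqxx.
rewrite [X in _ + X - _]big1 ?addr0; last first.
  by move=> i /andP[_]; rewrite -val_eqE /= => /negPf ->.
rewrite subr_ge0.
apply: (@le_trans _ _ (\sum_(i < N.+1) A * delta ^+ 2 * E)).
  rewrite [leRHS](bigID (fun i : 'I_N.+1 => (i < b.+1)%N)) /= lerDl.
  by apply: sumr_ge0 => i _; rewrite !mulr_ge0 ?exprn_ge0 // ltW.
rewrite sumr_const card_ord -[leLHS]mulr_natl.
have -> : N.+1%:R * (A * delta ^+ 2 * E) = A * delta * (delta * (N.+1%:R * E)).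
  by ring.
have -> : 2 * eps * A * delta = A * delta * (2 * eps) by ring.
rewrite ler_wpM2l ?mulr_ge0 ?(ltW delta_gt0) //.
by rewrite mulrDr mulr1 in delta_small; lra.
Qed.

(** Orthogonality to a stretched vector means that a combination of Newton
    polynomials vanishes at its node; [F] stands for their values there. *)
Lemma correction_orth (R : realType) (N c : nat) (r : nat -> nat -> R)
    (delta : R) (a F : nat -> R) : (c <= N.+1)%N ->
  (forall m, F m = \sum_(i < c) r m i * F i) ->
  \sum_(i < N.+1) (if (c <= i)%N then a i else correction N c r delta a i)
                  * ((- delta) ^+ i * F i) = 0.
Proof.
move=> cN F_def; rewrite (bigID (fun i : 'I_N.+1 => (c <= i)%N)) /=.
apply/eqP; rewrite addr_eq0; apply/eqP; rewrite -sumrN.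
under eq_bigr => m cm.
  rewrite cm F_def (big_ord_widen _ (fun i : nat => r m i * F i) cN) !mulr_sumr.
  over.
rewrite /= exchange_big /=; apply: eq_big => [i|i ic]; first by rewrite ltnNge.
rewrite leqNgt ic /= /correction mulNr opprK mulr_suml.
apply: eq_bigr => m cm.
have -> : (- delta) ^+ m = (- delta) ^+ (m - i) * (- delta) ^+ i :> R.
  by rewrite -exprD subnK // ltnW // (leq_trans ic).
by ring.
Qed.

(** The [i]-th coordinate of the [k]-th dictionary vector before
    normalization. The minus sign makes the first-order correction positive. *)
Definition stretched {R : realType} (delta : R) (k i : nat) : R :=
  (- delta) ^+ i * (newton i).[k%:R].

(** No span of stretched vectors approximates [a] better than the coordinate
    subspace of the same dimension. If [S] is an initial segment the two
    subspaces coincide, and the tail of [a] itself is a dual certificate;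
    otherwise the tail is completed by [correction]. *)
Lemma tail_le_dist (R : realType) (N : nat) (S : {set 'I_N.+1}) (eps M : R) :
  (#|S| <= N)%N -> 0 < eps -> 0 < M ->
  exists2 delta0, 0 < delta0 & forall delta, 0 < delta <= delta0 ->
    forall a : nat -> R,
      (forall i, (i < N)%N -> eps <= a i) ->
      (forall i, (i <= N)%N -> 0 <= a i <= M) ->
      forall z lam : 'I_N.+1 -> R,
        (forall i : 'I_N.+1,
           z i = a i - \sum_(k in S) lam k * stretched delta k i) ->
        \sum_(i < N.+1 | (#|S| <= i)%N) a i ^+ 2 <= \sum_i z i ^+ 2.
Proof.
move=> SN eps_gt0 M_gt0.
case: (initial_or_sum_gt S) => [initS|sum_gt].
  exists 1 => // delta _ a _ _ z lam z_def.
  apply: (dual_bound (w := fun i => if (#|S| <= i)%N then a i else 0)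
            (a := fun i : 'I_N.+1 => a i) _ _ _ z_def).
  - move=> k kS; apply: big1 => i _; case: leqP => [ci|_].
      2: by rewrite mul0r.
    rewrite /stretched newton_horner_eq0 ?mulr0 //.
    exact: leq_trans (initS k kS) ci.
  - by move=> i ->.
  - rewrite big1 // => i ic; rewrite leqNgt ic /=; ring.
have [r [r_red r_top]] := newton_reduce R S.
case cardS : #|S| => [|b].
  move: sum_gt; rewrite cardS big_ord0.
  have /eqP := cardS; rewrite cards_eq0 => /eqP ->.
  by rewrite big_set0.
have bN : (b < N)%N by rewrite -cardS.
have kappa_ge1 : 1 <= r b.+1 b.
  by rewrite -{1}cardS r_top // lerBrDr -!natr_sum nat1r ler_nat.
(* Dominates [a m / a b.+1]: [a b.+1 >= eps] unless [b.+1 = N], and then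
   [m = b.+1] is the only index. *)
pose K := 1 + M / eps.
have Meps_ge0 : 0 <= M / eps by rewrite divr_ge0 // ltW.
have K_ge0 : 0 <= K by rewrite addr_ge0.
have [delta0 delta0_gt0 gain] :=
  correction_gain bN eps_gt0 (ltW M_gt0) K_ge0 kappa_ge1.
exists delta0 => // delta delta_le a a_ge a_bd z lam z_def.
have aK m : (b < m <= N)%N -> a m <= K * a b.+1.
  move=> /andP[bm mN]; have /andP[a_ge0 _] := a_bd b.+1 bN.
  have [lt_bN|ge_bN] := ltnP b.+1 N.
    have /andP[_ am_le] := a_bd m mN; apply: le_trans am_le _.
    rewrite mulrDl mul1r -[leLHS]add0r lerD // -mulrA ler_peMr ?(ltW M_gt0) //.
    by rewrite ler_pdivlMl // mulr1 a_ge.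
  have -> : m = b.+1 by lia.
  by rewrite ler_peMl // lerDl.
apply: (dual_bound (a := fun i : 'I_N.+1 => a i)
  (w := fun i => if (b.+1 <= i)%N then a i else correction N b.+1 r delta a i)
  _ _ _ z_def).
- move=> k kS.
  apply: (@correction_orth _ _ _ _ _ _ (fun i => (newton i).[k%:R])).
    by rewrite ltnS ltnW.
  by move=> m; rewrite r_red // cardS.
- by move=> i ->.
- under eq_bigr => i ib do rewrite leqNgt ib /=.
  by apply: gain => //; apply: a_ge.
Qed.

Lemma uniform_delta (R : realType) (T : finType) (P : T -> R -> Prop) :
  (forall t, exists2 d0, 0 < d0 & forall d, 0 < d <= d0 -> P t d) ->
  exists2 d, 0 < d & forall t, P t d.
Proof.
move=> hP.
have /choice[d0 d0P] t : exists d0, 0 < d0 /\ forall d, 0 < d <= d0 -> P t d.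
  by have [d0 ? ?] := hP t; exists d0.
have min_gt0 : 0 < \big[Order.min/1]_t d0 t.
  by apply/bigmin_gtP; split=> // t _; case: (d0P t).
exists (\big[Order.min/1]_t d0 t) => // t.
by apply: (d0P t).2; rewrite min_gt0 bigmin_le.
Qed.

(** There are finitely many index sets, so one [delta] serves all of them. *)
Lemma exists_good_delta (R : realType) (eps M : R) (N : nat) :
  0 < eps -> 0 < M ->
  exists2 delta, 0 < delta & forall S : {set 'I_N.+1}, (#|S| <= N)%N ->
    forall a : nat -> R,
      (forall i, (i < N)%N -> eps <= a i) ->
      (forall i, (i <= N)%N -> 0 <= a i <= M) ->
      forall z lam : 'I_N.+1 -> R,
        (forall i : 'I_N.+1,
           z i = a i - \sum_(k in S) lam k * stretched delta k i) ->
        \sum_(i < N.+1 | (#|S| <= i)%N) a i ^+ 2 <= \sum_i z i ^+ 2.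
Proof.
move=> eps_gt0 M_gt0; apply: uniform_delta => S.
have [leSN|] := leqP #|S| N; last by exists 1.
have [d0 d0_gt0 d0P] := tail_le_dist leSN eps_gt0 M_gt0.
by exists d0 => // d d_bd _; apply: d0P.
Qed.

(** * The dictionary and its approximants *)

(** A triangular family spans the same flag as the coordinate vectors; this
    yields both the spanning property of the dictionary and the optimal
    approximants. *)
Lemma triangular_span (F : fieldType) (p : nat) (g : 'I_p -> 'rV[F]_p) :
  (forall k i : 'I_p, (k < i)%N -> g k 0 i = 0) ->
  (forall k, g k 0 k != 0) ->
  forall n (v : 'rV[F]_p), (n <= p)%N ->
    (forall i : 'I_p, (n <= i)%N -> v 0 i = 0) ->
    exists lam : 'I_p -> F, v = \sum_(k < p | (k < n)%N) lam k *: g k.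
Proof.
move=> g_trig g_diag; elim=> [|n IHn] v np v_supp.
  exists (fun=> 0); rewrite big_pred0 //; apply/rowP => i.
  by rewrite v_supp // mxE.
pose k := Ordinal np; pose t := v 0 k / g k 0 k.
have [|i ni|lam v_def] := IHn (v - t *: g k); first exact: ltnW.
  rewrite !mxE; have [->|ne_ik] := eqVneq i k; first by rewrite divfK ?subrr.
  have lt_ni : (n < i)%N by rewrite ltn_neqAle ni andbT eq_sym.
  by rewrite v_supp // g_trig // mulr0 subrr.
exists (fun j => if j == k then t else lam j).
rewrite (bigD1 k) //= eqxx -[LHS](subrK (t *: g k)) addrC v_def; congr (_ + _).
apply: eq_big => [j|j jn]; last by rewrite -val_eqE /= (ltn_eqF jn).
by rewrite -val_eqE /= ltnS; lia.
Qed.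

Lemma enormZ (R : realType) n (c : R) (x : 'rV[R]_n) :
  enorm (c *: x) = `|c| * enorm x.
Proof.
rewrite /enorm -sqrtr_sqr -sqrtrM ?sqr_ge0 // mulr_sumr.
by congr Num.sqrt; apply: eq_bigr => i _; rewrite mxE exprMn.
Qed.

Lemma enorm_eq0 (R : realType) n (x : 'rV[R]_n) : enorm x = 0 -> x = 0.
Proof.
move=> /eqP; rewrite sqrtr_eq0 => le0; apply/rowP => i; rewrite mxE.
apply/eqP; rewrite -sqrf_eq0 eq_le sqr_ge0 andbT; apply: le_trans le0.
by rewrite (bigD1 i) //= lerDl sumr_ge0 // => j _; rewrite sqr_ge0.
Qed.

Lemma telescoping_tail (R : realType) N (d : nat -> R) n : (n <= N.+1)%N ->
  \sum_(i < N.+1 | (n <= i)%N) (d i ^+ 2 - d i.+1 ^+ 2)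
  = d n ^+ 2 - d N.+1 ^+ 2.
Proof.
move=> nN.
rewrite -(big_geq_mkord n N.+1 xpredT (fun i => d i ^+ 2 - d i.+1 ^+ 2)).
rewrite -[RHS]opprB -(telescope_sumr (fun i => d i ^+ 2)) // -sumrN.
by apply: eq_bigr => i _; rewrite opprB.
Qed.

Local Open Scope classical_set_scope.

Lemma inf_min (R : realType) (A : set R) (x : R) :
  A x -> lbound A x -> inf A = x.
Proof.
move=> Ax lbx; apply/eqP; rewrite eq_le lb_le_inf ?andbT //; last by exists x.
by apply: ge_inf => //; exists x.
Qed.

Definition stretched_row {R : realType} (N : nat) (delta : R) (k : 'I_N.+1) :
    'rV[R]_N.+1 :=
  \row_i stretched delta k i.

Definition stretched_unit {R : realType} (N : nat) (delta : R) (k : 'I_N.+1) :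
    'rV[R]_N.+1 :=
  (enorm (stretched_row delta k))^-1 *: stretched_row delta k.

Lemma stretched_row_enorm_neq0 (R : realType) N (delta : R) (k : 'I_N.+1) :
  0 < delta -> enorm (stretched_row delta k) != 0.
Proof.
move=> delta_gt0; apply/eqP => /enorm_eq0 /rowP /(_ k); rewrite !mxE => /eqP.
rewrite mulf_eq0 expf_eq0 oppr_eq0 (gt_eqF delta_gt0) andbF /=.
by rewrite gt_eqF // newton_horner_gt0.
Qed.

Lemma stretched_unit_span (R : realType) N (delta : R) n (v : 'rV[R]_N.+1) :
  0 < delta -> (n <= N.+1)%N ->
  (forall i : 'I_N.+1, (n <= i)%N -> v 0 i = 0) ->
  exists lam : 'I_N.+1 -> R,
    v = \sum_(k < N.+1 | (k < n)%N) lam k *: stretched_unit delta k.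
Proof.
move=> delta_gt0; apply: triangular_span => [k i ki|k]; rewrite !mxE.
  by rewrite /stretched newton_horner_eq0 // !mulr0.
rewrite !mulf_neq0 ?invr_eq0 ?stretched_row_enorm_neq0 ?expf_neq0
  ?oppr_eq0 ?(gt_eqF delta_gt0) //.
by rewrite gt_eqF // newton_horner_gt0.
Qed.

Lemma stretched_dictionary (R : realType) N (delta : R) : 0 < delta ->
  dictionary (range (@stretched_unit R N delta)).
Proof.
move=> delta_gt0; split=> [_ [k _ <-]|] /=.
  rewrite enormZ ger0_norm ?invr_ge0 ?sqrtr_ge0 //.
  by rewrite mulVf ?stretched_row_enorm_neq0.
apply/seteqP; split=> // x _; exists [seq stretched_unit delta k | k : 'I_N.+1].
  by move=> g /mapP[k _ ->]; exists k.
have [|lam ->] := @stretched_unit_span R N delta N.+1 x delta_gt0 (leqnn _).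
  by move=> i; rewrite leqNgt ltn_ord.
by apply: memv_suml => k _; rewrite memvZ // memv_span // fintype.image_f.
Qed.

(** Repeated dictionary elements are merged, so a set [S] with fewer than
    [n] elements may come out. *)
Lemma Sigma_subset (R : realType) N (delta : R) n (y : 'rV[R]_N.+1) :
  Sigma n (range (@stretched_unit R N delta)) y ->
  exists (S : {set 'I_N.+1}) (lam : 'I_N.+1 -> R),
    (#|S| <= n)%N /\
    forall i, y 0 i = \sum_(k in S) lam k * stretched delta k i.
Proof.
move=> [lam [g [gD ->]]].
have /choice[f fP] k : exists j, stretched_unit delta j = g k.
  by case: (gD k) => j _ <-; exists j.
exists [set f k | k in 'I_n]%SET.
exists (fun j => (\sum_(k < n | f k == j) lam k)
                 * (enorm (stretched_row delta j))^-1).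
split; first by rewrite -[leqRHS]card_ord leq_imset_card.
move=> i; rewrite summxE (partition_big f (mem [set f k | k in 'I_n]%SET)) /=.
  apply: eq_bigr => j _; rewrite -mulrA mulr_suml; apply: eq_bigr => k /eqP fk.
  by rewrite -fP fk !mxE.
by move=> k _; apply: imset_f.
Qed.

(** * Realizing prescribed distances *)

Theorem theorem4 (R : realType) (eps M : R) (N : nat)
    (eps_gt0 : 0 < eps) (M_gt0 : 0 < M) (N_gt0 : (0 < N)%N) :
  exists D : set 'rV[R]_N.+1,
    dictionary D /\
    forall d : nat -> R,
      d 0%N < M ->
      (forall n : nat, (n < N)%N -> d n.+1 < d n) ->
      0 < d N ->
      (forall n : nat, (n < N)%N -> eps < d n - d n.+1) ->
      exists x : 'rV[R]_N.+1,
        forall n : nat, (n <= N)%N -> sigma D n x = d n.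
Proof.
have [delta delta_gt0 delta_good] := exists_good_delta N eps_gt0 M_gt0.
exists (range (@stretched_unit R N delta)); split.
  exact: stretched_dictionary.
move=> d d0_lt d_dec dN_gt0 d_gap.
(* Reading the distance after [d N] as 0 puts [a N = d N] under the formula
     of the other coordinates. *)
pose e i := if (i <= N)%N then d i else 0.
have e_le i : (i <= N)%N -> e i = d i by rewrite /e => ->.
have e_last : e N.+1 = 0 by rewrite /e ltnn.
have d_anti m n : (m <= n <= N)%N -> d n <= d m.
  move=> /andP[mn nN]; rewrite -(subnKC mn) in nN *.
  elim: (n - m)%N nN => [|j IHj]; first by rewrite addn0.
  rewrite addnS => jN; apply: le_trans (IHj (ltnW jN)).
  exact/ltW/d_dec.
have d_gt0 n : (n <= N)%N -> 0 < d n.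
  by move=> nN; apply: lt_le_trans dN_gt0 (d_anti _ _ _); rewrite nN leqnn.
have e_ge0 i : 0 <= e i.
  by rewrite /e; case: ifP => // iN; rewrite ltW // d_gt0.
have e_dec i : (i <= N)%N -> e i.+1 <= e i.
  rewrite leq_eqVlt => /predU1P[->|iN]; first by rewrite e_last.
  by rewrite !e_le // ?ltW ?d_dec // ltnW.
have sq_ge0 i : (i <= N)%N -> 0 <= e i ^+ 2 - e i.+1 ^+ 2.
  by move=> iN; rewrite subr_ge0 ler_pXn2r ?nnegrE // e_dec.
pose a i := Num.sqrt (e i ^+ 2 - e i.+1 ^+ 2).
have a_sq i : (i <= N)%N -> a i ^+ 2 = e i ^+ 2 - e i.+1 ^+ 2.
  by move=> iN; rewrite sqr_sqrtr // sq_ge0.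
have a_tail n : (n <= N)%N ->
    \sum_(i < N.+1 | (n <= i)%N) a i ^+ 2 = d n ^+ 2.
  move=> nN; rewrite (eq_bigr (fun i : 'I_N.+1 => e i ^+ 2 - e i.+1 ^+ 2)).
    2: by move=> i _; rewrite a_sq // -ltnS.
  by rewrite telescoping_tail ?e_last ?expr0n ?subr0 ?e_le // ltnW.
have a_ge i : (i < N)%N -> eps <= a i.
  move=> iN; rewrite -(ler_pXn2r (ltn0Sn 1)) ?nnegrE ?sqrtr_ge0 //; last first.
    exact: ltW.
  rewrite a_sq ?(ltnW iN) // !e_le ?(ltnW iN) // subr_sqr !expr2.
  have gap := d_gap i iN; have := d_gt0 i.+1 iN => di_gt0.
  by rewrite ler_pM ?(ltW eps_gt0) ?(ltW gap) //; lra.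
have a_bd i : (i <= N)%N -> 0 <= a i <= M.
  move=> iN; rewrite sqrtr_ge0 /= (@le_trans _ _ (e i)) //.
    rewrite -[leRHS](ger0_norm (e_ge0 i)) -sqrtr_sqr ler_wsqrtr //.
    by rewrite gerBl sqr_ge0.
  by rewrite e_le // (le_trans _ (ltW d0_lt)) // d_anti.
pose x : 'rV[R]_N.+1 := \row_i a i.
exists x => n nN.
have dn_ge0 : 0 <= d n by rewrite ltW // d_gt0.
have sqrt_tail : Num.sqrt (\sum_(i < N.+1 | (n <= i)%N) a i ^+ 2) = d n.
  by rewrite a_tail // sqrtr_sqr ger0_norm.
case: n nN dn_ge0 sqrt_tail => [|n] nN dn_ge0 sqrt_tail.
  rewrite -sqrt_tail /sigma /enorm; congr Num.sqrt.
  by apply: eq_bigr => i _; rewrite mxE.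
apply: inf_min.
(* The distance is attained at the truncation of [x]. *)
- pose y : 'rV[R]_N.+1 := \row_(i < N.+1) if (i < n.+1)%N then a i else 0.
  have nN1 : (n.+1 <= N.+1)%N by rewrite ltnW.
  have [|lam y_def] := @stretched_unit_span R N delta n.+1 y delta_gt0 nN1.
    by move=> i ni; rewrite mxE ltnNge ni.
  exists y.
    exists (fun k => lam (widen_ord nN1 k)).
    exists (fun k => stretched_unit delta (widen_ord nN1 k)).
    split; first by move=> k; exists (widen_ord nN1 k).
    by rewrite y_def (big_ord_narrow nN1).
  rewrite -sqrt_tail /enorm; congr Num.sqrt.
  rewrite [RHS]big_mkcond; apply: eq_bigr => i _; rewrite !mxE.
  by case: (ltnP i n.+1) => _; rewrite ?subr0 // subrr expr0n.
(* When [#|S| <= n], the tail that starts at [#|S|] is at least as large. *)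
- move=> _ [y /Sigma_subset[S [lam [cardS y_def]]] <-].
  have leSN : (#|S| <= N)%N by apply: leq_trans cardS nN.
  have le_dist : Num.sqrt (d #|S| ^+ 2) <= enorm (x - y).
    rewrite ler_wsqrtr // -a_tail //.
    apply: (delta_good S leSN a a_ge a_bd (fun i => (x - y) 0 i) lam) => i.
    by rewrite !mxE y_def.
  apply: le_trans le_dist; rewrite sqrtr_sqr ger0_norm; last first.
    by rewrite ltW // d_gt0.
  by rewrite d_anti // cardS.
Qed.
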